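(* Let $\Gamma\le E(n)$ be a discrete group of isometries of $\mathbb{R}^n$, and let $A\colon\mathbb{R}^n\to\mathbb{R}^n$ be a linear conformal map. Suppose that $A$ is expanding and $A\Gamma A^{-1}\subset\Gamma$. Then $\dim\Gamma_T=\dim\Gamma$, where $\Gamma_T$ is the translation subgroup of $\Gamma$.
   Context: $E(n)$ denotes the group of isometries of $\mathbb{R}^n$; each $\gamma\in E(n)$ has the form $x\mapsto Bx+b$ with $B\in O(n)$, $b\in\mathbb{R}^n$, and we write $\operatorname{ort}(\gamma)=B$, $T(\gamma)=b$. $E(n)$ carries the topology of $O(n)\times\mathbb{R}^n$; discreteness refers to this topology. The translation subgroup is $\Gamma_T=\{\gamma\in\Gamma:\operatorname{ort}(\gamma)=\mathrm{id}\}$. For a discrete $\Gamma\le E(n)$, a subgroup $G\le\Gamma$ and an affine subspace $V$, $(G,V)$ is a cocompact translation pair of $\Gamma$ if $gV=V$ and $g|_V$ is a translation of $V$ for all $g\in G$, and $V/G$ is compact; it is a finite index cocompact translation pair if moreover $[\Gamma:G]<\infty$. Such pairs always exist, and $\dim\Gamma:=\dim V$ for any such pair (independent of the choice); $\dim\Gamma_T$ is defined likewise. A linear conformal map is $A=\lambda A'$ with $\lambda>0$ and $A'\in SO(n)$; it is expanding if $\lambda>1$. $A\Gamma A^{-1}=\{A\gamma A^{-1}:\gamma\in\Gamma\}$, viewed as maps of $\mathbb{R}^n$. *)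

(* Defs.v *)
From mathcomp Require Import all_boot.
From mathcomp Require Import fingroup perm.
From Stdlib Require Import Reals.

Set Implicit Arguments.
Unset Strict Implicit.
Unset Printing Implicit Defensive.

Local Open Scope R_scope.

Definition vec (n : nat) := 'I_n -> R.
Definition mat (n : nat) := 'I_n -> 'I_n -> R.

Definition Rsum (n : nat) (f : 'I_n -> R) : R := \big[Rplus/0]_(i < n) f i.

Definition vadd n (x y : vec n) : vec n := fun i => x i + y i.
Definition vsub n (x y : vec n) : vec n := fun i => x i - y i.
Definition vzero n : vec n := fun _ => 0.
Definition vnorm n (x : vec n) : R := sqrt (Rsum (fun i => x i * x i)).

Definition mulmv n (B : mat n) (x : vec n) : vec n :=
  fun i => Rsum (fun j => B i j * x j).
Definition mulmm n (B C : mat n) : mat n :=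
  fun i j => Rsum (fun k => B i k * C k j).
Definition idm n : mat n := fun i j => if i == j then 1 else 0.
Definition scalem n (l : R) (B : mat n) : mat n := fun i j => l * B i j.

Definition orthogonal n (B : mat n) : Prop :=
  forall i j : 'I_n, Rsum (fun k => B k i * B k j) = idm i j.

Definition detR n (B : mat n) : R :=
  \big[Rplus/0]_(s : 'S_n)
     ((-1) ^ (if odd_perm s then 1%nat else 0%nat) * \big[Rmult/1]_(i < n) B i (s i)).

Definition special_orthogonal n (B : mat n) : Prop :=
  orthogonal B /\ detR B = 1.

Definition isom (n : nat) := (mat n * vec n)%type.
Definition ort n (g : isom n) : mat n := fst g.
Definition transl n (g : isom n) : vec n := snd g.
Definition act n (g : isom n) (x : vec n) : vec n :=
  vadd (mulmv (ort g) x) (transl g).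
Definition isom_id n : isom n := (@idm n, @vzero n).
Definition isom_comp n (g h : isom n) : isom n :=
  (mulmm (ort g) (ort h), vadd (mulmv (ort g) (transl h)) (transl g)).

Definition subgroup_E n (Gam : isom n -> Prop) : Prop :=
  (forall g, Gam g -> orthogonal (ort g)) /\
  Gam (@isom_id n) /\
  (forall g h, Gam g -> Gam h -> Gam (isom_comp g h)) /\
  (forall g, Gam g -> exists h, Gam h /\ isom_comp g h = @isom_id n
                               /\ isom_comp h g = @isom_id n).

(* Distance on O(n) x R^n (a norm on the product; induces its topology). *)
Definition isom_dist n (g h : isom n) : R :=
  Rsum (fun i => Rsum (fun j => Rabs (ort g i j - ort h i j)))
  + Rsum (fun i => Rabs (transl g i - transl h i)).

Definition discrete n (Gam : isom n -> Prop) : Prop :=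
  forall g, Gam g -> exists eps, 0 < eps /\
    forall h, Gam h -> h <> g -> eps <= isom_dist g h.

Definition transl_subgroup n (Gam : isom n -> Prop) : isom n -> Prop :=
  fun g => Gam g /\ ort g = @idm n.

Definition lin_comb n k (c : 'I_k -> R) (U : 'I_k -> vec n) : vec n :=
  fun i => Rsum (fun l => c l * U l i).
Definition lin_indep n k (U : 'I_k -> vec n) : Prop :=
  forall c : 'I_k -> R, lin_comb c U = @vzero n -> forall l, c l = 0.
Definition affine_dim n (V : vec n -> Prop) (k : nat) : Prop :=
  exists (p : vec n) (U : 'I_k -> vec n), lin_indep U /\
    forall x, V x <-> exists c : 'I_k -> R, x = vadd p (lin_comb c U).
Definition affine_subspace n (V : vec n -> Prop) : Prop :=
  exists k, affine_dim V k.

(* V/G compact, for G acting on V by translations: there is a bounded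
   region of V whose G-translates cover V. *)
Definition cocompact_on n (G : isom n -> Prop) (V : vec n -> Prop) : Prop :=
  exists x0 : vec n, V x0 /\ exists Rad : R,
    forall v, V v -> exists g, G g /\ vnorm (vsub (act g x0) v) <= Rad.

Definition cocompact_translation_pair n (Gam G : isom n -> Prop)
    (V : vec n -> Prop) : Prop :=
  subgroup_E G /\ (forall g, G g -> Gam g) /\ affine_subspace V /\
  (forall g, G g ->
     (forall x, V x -> V (act g x)) /\
     (forall y, V y -> exists x, V x /\ act g x = y) /\
     (exists t : vec n, forall x, V x -> act g x = vadd x t)) /\
  cocompact_on G V.

Definition finite_index n (Gam G : isom n -> Prop) : Prop :=
  exists reps : seq (isom n), (forall r, List.In r reps -> Gam r) /\
    forall g, Gam g -> exists r h, List.In r reps /\ G h /\ g = isom_comp r h.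

Definition fi_cocompact_translation_pair n (Gam G : isom n -> Prop)
    (V : vec n -> Prop) : Prop :=
  cocompact_translation_pair Gam G V /\ finite_index Gam G.

Definition expanding_conformal n (A : mat n) : Prop :=
  exists (lam : R) (A' : mat n), 1 < lam /\ special_orthogonal A' /\
    A = scalem lam A'.

(* A Gam A^{-1} subset Gam, phrased as: for every g in Gam there is h in Gam
   with h o A = A o g, i.e. h = A g A^{-1}. *)
Definition conj_into n (A : mat n) (Gam : isom n -> Prop) : Prop :=
  forall g, Gam g -> exists h, Gam h /\
    forall x, act h (mulmv A x) = mulmv A (act g x).

(* Main.v *)
(** Write [sigma g = A g A^-1] and [A = lam A'].  By compactness of the
    orthogonal group some power [A'^m] is close to the identity.  Given [g] in [G]
    translating [V] by [t], some power [sigma^m (g^p)] lies in [G] and commutes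
    with [g^p], because the conjugates of an element of [G] by powers of another
    one all move a base point of [V] in the same way and hence, by discreteness,
    take finitely many values.  The linear parts of the powers of
    [sigma^m (g^p) g^-p] are then commutators with [A'^m], uniformly close to the
    identity; as the orthogonal group has no small subgroups,
    [sigma^m (g^p) g^-p] is a translation, by the vector [p (A^m - 1) t].  Since
    [A^m - 1] is injective and the vectors [t] span the direction of [V] by
    cocompactness, the translations of [Gam] span a space of dimension at least
    [dim V].

    An isometry [x |-> B x + b] is represented by its homogeneous matrix
    [aff B b], so that composition and powers are those of a matrix ring. *)
From Stdlib Require Import Reals Classical FunctionalExtensionality.
From mathcomp Require Import all_boot all_order all_algebra.
From mathcomp Require Import archimedean ring lra Rstruct.
Require Import Defs.

Set Implicit Arguments.
Unset Strict Implicit.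
Unset Printing Implicit Defensive.

Import Order.TTheory GRing.Theory Num.Theory.

Local Open Scope ring_scope.

Lemma pigeonhole (T : finType) (P : nat -> T -> Prop) :
  (forall i, exists c, P i c) -> exists i j c, [/\ (i < j)%N, P i c & P j c].
Proof.
move=> exP.
(* Finite choice over the first [#|T|.+1] indices gives a map that cannot be injective. *)
have [h Ph] := @fin_all_exists 'I_#|T|.+1 _ (fun i => P i) (fun i => exP i).
have /injectivePn[i [j neq_ij eq_h]] : ~~ injectiveb h.
  apply/negP => /injectiveP/leq_card.
  by rewrite card_ord ltnn.
have [lt_ij|lt_ji|/val_inj eq_ij] := ltngtP i j.
- by exists i, j, (h i); split=> //; rewrite eq_h.
- by exists j, i, (h i); split=> //; rewrite eq_h.
- by rewrite eq_ij eqxx in neq_ij.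
Qed.

(** * The entrywise l1 norm of matrices *)

Section L1Norm.
Variable F : realFieldType.

Definition l1norm m n (M : 'M[F]_(m, n)) : F := \sum_i \sum_j `|M i j|.

Lemma l1norm_ge0 m n (M : 'M[F]_(m, n)) : 0 <= l1norm M.
Proof. by apply: sumr_ge0 => i _; apply: sumr_ge0. Qed.

Lemma ler_l1norm m n (M : 'M[F]_(m, n)) i j : `|M i j| <= l1norm M.
Proof.
rewrite /l1norm (bigD1 i) //= (bigD1 j) //= -addrA lerDl addr_ge0 //.
  exact: sumr_ge0.
by apply: sumr_ge0 => k _; apply: sumr_ge0.
Qed.

Lemma l1norm_le m n (M : 'M[F]_(m, n)) (c : F) :
  (forall i j, `|M i j| <= c) -> l1norm M <= (m * n)%:R * c.
Proof.
move=> le_Mc.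
apply: (@le_trans _ _ (\sum_(i < m) \sum_(j < n) c)).
  by apply: ler_sum => i _; apply: ler_sum.
by rewrite !sumr_const !card_ord -mulrnA mulr_natl mulnC.
Qed.

Lemma l1norm0 m n : l1norm (0 : 'M[F]_(m, n)) = 0.
Proof.
by apply: big1 => i _; apply: big1 => j _; rewrite mxE normr0.
Qed.

Lemma l1norm_eq0 m n (M : 'M[F]_(m, n)) : l1norm M <= 0 -> M = 0.
Proof.
move=> M0; apply/matrixP=> i j; rewrite mxE; apply/eqP; rewrite -normr_le0.
exact: le_trans (ler_l1norm _ _ _) M0.
Qed.

Lemma l1normD m n (M P : 'M[F]_(m, n)) : l1norm (M + P) <= l1norm M + l1norm P.
Proof.
rewrite /l1norm -big_split /=; apply: ler_sum => i _.
rewrite -big_split /=; apply: ler_sum => j _.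
by rewrite mxE ler_normD.
Qed.

Lemma l1normN m n (M : 'M[F]_(m, n)) : l1norm (- M) = l1norm M.
Proof. by apply: eq_bigr => i _; apply: eq_bigr => j _; rewrite mxE normrN. Qed.

Lemma l1normB m n (M P : 'M[F]_(m, n)) : l1norm (M - P) <= l1norm M + l1norm P.
Proof. by rewrite -(l1normN P) l1normD. Qed.

Lemma l1normZ m n a (M : 'M[F]_(m, n)) : l1norm (a *: M) = `|a| * l1norm M.
Proof.
rewrite /l1norm mulr_sumr; apply: eq_bigr => i _.
by rewrite mulr_sumr; apply: eq_bigr => j _; rewrite mxE normrM.
Qed.

Lemma l1normM m n p (M : 'M[F]_(m, n)) (P : 'M[F]_(n, p)) :
  l1norm (M *m P) <= l1norm M * l1norm P.
Proof.
rewrite /l1norm mulr_suml; apply: ler_sum => i _.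
apply: (@le_trans _ _ (\sum_j \sum_k `|M i k| * `|P k j|)).
  apply: ler_sum => j _; rewrite mxE; apply: le_trans (ler_norm_sum _ _ _) _.
  by apply: ler_sum => k _; rewrite normrM.
rewrite exchange_big mulr_suml; apply: ler_sum => k _.
rewrite -mulr_sumr ler_wpM2l //.
by rewrite [leRHS](bigD1 k) //= lerDl; apply: sumr_ge0 => l _; apply: sumr_ge0.
Qed.

Lemma l1norm_tr m n (M : 'M[F]_(m, n)) : l1norm M^T = l1norm M.
Proof.
rewrite /l1norm exchange_big; apply: eq_bigr => i _.
by apply: eq_bigr => j _; rewrite mxE.
Qed.

Lemma l1norm_block m1 m2 n1 n2 (A : 'M[F]_(m1, n1)) (B : 'M_(m1, n2))
    (C : 'M_(m2, n1)) (D : 'M_(m2, n2)) :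
  l1norm (block_mx A B C D) = l1norm A + l1norm B + (l1norm C + l1norm D).
Proof.
rewrite /l1norm big_split_ord /=; congr (_ + _); rewrite -big_split /=.
  apply: eq_bigr => i _; rewrite big_split_ord /=.
  by congr (_ + _); apply: eq_bigr => j _; rewrite (block_mxEul, block_mxEur).
apply: eq_bigr => i _; rewrite big_split_ord /=.
by congr (_ + _); apply: eq_bigr => j _; rewrite (block_mxEdl, block_mxEdr).
Qed.

Lemma orthogonal_entry_le1 n (B : 'M[F]_n) i j :
  B^T *m B = 1%:M -> `|B i j| <= 1.
Proof.
move=> BB; have := congr1 (fun M : 'M_n => M j j) BB.
rewrite !mxE eqxx (bigD1 i) //= mxE -expr2 -real_normK ?num_real //.
have : 0 <= \sum_(k < n | k != i) B^T j k * B k j.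
  by apply: sumr_ge0 => k _; rewrite mxE -expr2 sqr_ge0.
set s := \sum_(_ < _ | _) _; have := normr_ge0 (B i j).
by set b := `|_| => b0 s0 /= eq1; nra.
Qed.

Lemma l1norm_orthogonal n (B : 'M[F]_n) :
  B^T *m B = 1%:M -> l1norm B <= (n * n)%:R.
Proof.
move=> BB; rewrite -[leRHS]mulr1; apply: l1norm_le => i j.
exact: orthogonal_entry_le1.
Qed.

End L1Norm.

(** * Archimedean substitutes for limits and compactness *)

Section Archimedean.
Variable F : archiRealFieldType.

Lemma bounded_multiples_eq0 (c d : F) :
  0 <= c -> (forall k : nat, c *+ k <= d) -> c = 0.
Proof.
move=> c0 le_d; apply/eqP; rewrite eq_le c0 andbT leNgt; apply/negP => c_gt0.
have d0 : 0 <= d by have := le_d 0%N.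
have := archi_boundP (divr_ge0 d0 c0); set k := Num.Def.archi_bound _.
by rewrite ltr_pdivrMr // mulr_natl ltNge le_d.
Qed.

(** No small subgroups: if [C = B - 1], then [B ^+ 2 - 1 = C + C + C * C]. While [C] has norm at
    most 1/2, squaring multiplies the distance to 1 by at least 3/2, yet all powers stay within 1/2
    of 1. *)
Lemma pow_near1_eq1 n (B : 'M[F]_n) :
  (forall j, l1norm (B ^+ j - 1) <= 2^-1) -> B = 1.
Proof.
move=> near1; apply/eqP; rewrite -subr_eq0; apply/eqP/l1norm_eq0.
suff -> : l1norm (B - 1) = 0 by [].
apply: (@bounded_multiples_eq0 _ 1); first exact: l1norm_ge0.
(* Linear growth in the number of squarings is weaker than the factor 3/2, but already conflicts
   with boundedness unless [B = 1]. *)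
have grow k : l1norm (B - 1) *+ k.+2 <= 2 * l1norm (B ^+ (2 ^ k) - 1).
  elim: k => [|k IHk]; first by rewrite mulr_natl.
  set C := B ^+ (2 ^ k) - 1 in IHk.
  have sqC : B ^+ (2 ^ k.+1) - 1 = C + C + C * C.
    rewrite expnSr exprM /C; set D := B ^+ _.
    rewrite -[D in LHS](subrK 1) -/C expr2 mulrDl mulrDr mulr1 mul1r.
    by rewrite addrA addrK -addrA addrC.
  have : l1norm (C + C) <= l1norm (B ^+ (2 ^ k.+1) - 1) + l1norm (C * C).
    by apply: le_trans _ (l1normB _ _); rewrite sqC addrK.
  rewrite -mulr2n -scaler_nat l1normZ normr_nat.
  have le_CC : l1norm (C * C) <= l1norm C * 2^-1.
    apply: le_trans (l1normM C C) _.
    by apply: ler_wpM2l; [exact: l1norm_ge0 | exact: near1].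
  have ge0 : 0 <= l1norm (B - 1) *+ k by rewrite mulrn_wge0 ?l1norm_ge0.
  move: IHk le_CC ge0; rewrite !(mulrS (l1norm (B - 1))).
  by move: (l1norm C) (l1norm (C * C)) (l1norm (B - 1)) (_ *+ k) => *; lra.
move=> k; apply: le_trans (le_trans _ (grow k)) _.
  rewrite -(mulr_natr _ k) -(mulr_natr _ k.+2) ler_wpM2l ?l1norm_ge0 // ler_nat.
  exact: leq_trans (leqnSn k) (leqnSn _).
by rewrite -ler_pdivlMl // mulr1.
Qed.

(** Total boundedness of the orthogonal group: the entries lie in [-1, 1], which is cut into cells
    of length 1/K with n^2/K < d, and two of the matrices share all their cells. *)
Lemma orthogonal_pigeonhole n (O : nat -> 'M[F]_n) (d : F) :
  (forall i, (O i)^T *m O i = 1%:M) -> 0 < d ->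
  exists i j, (i < j)%N /\ l1norm (O i - O j) < d.
Proof.
move=> orthO d0.
have := archi_boundP (divr_ge0 (ler0n F (n * n)) (ltW d0)).
move: (Num.Def.archi_bound _) => K; rewrite ltr_pdivrMr // => ltK.
have K0 : 0 < K%:R :> F.
  by rewrite -(pmulr_lgt0 _ d0); apply: le_lt_trans ltK.
(* The shift by 1 makes the truncated number nonnegative; the entry 1 falls into cell 2K, hence
   [(K + K).+1] cells. *)
pose cell (x : F) := Num.truncn ((x + 1) * K%:R).
pose f i := [ffun ab : 'I_n * 'I_n =>
  inord (cell (O i ab.1 ab.2)) : 'I_(K + K).+1].
have [|i [j [c [lt_ij fi fj]]]] := @pigeonhole _ (fun i c => f i = c).
  by move=> i; exists (f i).
have /ffunP eq_f : f i = f j by rewrite fi fj.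
exists i, j; split=> //.
apply: (@le_lt_trans _ _ ((n * n)%:R * K%:R^-1)); last first.
  by rewrite ltr_pdivrMr // mulrC.
apply: l1norm_le => a b; rewrite !mxE.
have ge0 k : 0 <= (O k a b + 1) * K%:R.
  have := orthogonal_entry_le1 a b (orthO k); rewrite ler_norml => /andP[? _].
  by rewrite mulr_ge0 // -lerBlDr sub0r.
have cellK k : (cell (O k a b) < (K + K).+1)%N.
  have := orthogonal_entry_le1 a b (orthO k); rewrite ler_norml => /andP[_ ?].
  rewrite ltnS /cell truncn_le_nat -natr1 natrD.
  have : 0 <= (1 - O k a b) * K%:R by rewrite mulr_ge0 ?subr_ge0 // ltW.
  by move=> ?; lra.
move/(congr1 val): (eq_f (a, b)); rewrite !ffunE /= !inordK // => eq_cell.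
have /andP[] := truncn_itv (ge0 i); have /andP[] := truncn_itv (ge0 j).
rewrite -/(cell (O i a b)) -/(cell (O j a b)) eq_cell.
rewrite -addn1 natrD => le_j lt_j le_i lt_i.
rewrite -[K%:R^-1]mul1r ler_pdivlMr // -[K%:R in leLHS]gtr0_norm //.
rewrite -normrM ler_norml.
by apply/andP; split; lra.
Qed.
End Archimedean.

(** * Orthogonal matrices: recurrence of powers and commutators *)

Section Orthogonal.
Variables (F : archiRealFieldType) (n : nat).
Implicit Types B C Q : 'M[F]_n.

Lemma orthogonalV B : B^T *m B = 1%:M -> B *m B^T = 1%:M.
Proof. exact: mulmx1C. Qed.

Lemma orthogonalM B C :
  B^T *m B = 1%:M -> C^T *m C = 1%:M -> (B *m C)^T *m (B *m C) = 1%:M.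
Proof. by move=> BB CC; rewrite trmx_mul mulmxA -(mulmxA C^T) BB mulmx1. Qed.

Lemma orthogonalX B k : B^T *m B = 1%:M -> (B ^+ k)^T *m B ^+ k = 1%:M.
Proof.
move=> BB; elim: k => [|k IHk]; first by rewrite expr0 trmx1 mulmx1.
by rewrite exprS; apply: orthogonalM.
Qed.

Lemma trmxX B k : (B ^+ k)^T = B^T ^+ k.
Proof.
elim: k => [|k IHk]; first by rewrite !expr0 trmx1.
by rewrite exprS exprSr [LHS]trmx_mul IHk.
Qed.

(** Two close powers [Q ^+ i] and [Q ^+ j] are multiplied by the inverse of the first, [(Q ^+ i)^T],
    whose norm is at most n^2. *)
Lemma orthogonal_recurrence Q (e : F) : Q^T *m Q = 1%:M -> 0 < e ->
  exists m, (0 < m)%N /\ l1norm (Q ^+ m - 1) < e.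
Proof.
move=> QQ e0.
(* The summand 1 keeps the divisor positive when [n] is 0. *)
have c0 : 0 < (n * n)%:R + 1 :> F by rewrite ltr_wpDl.
have [i [j [lt_ij near]]] :=
  orthogonal_pigeonhole (fun i => orthogonalX i QQ) (divr_gt0 e0 c0).
exists (j - i)%N; split; first by rewrite subn_gt0.
have -> : Q ^+ (j - i) - 1 = - ((Q ^+ i)^T *m (Q ^+ i - Q ^+ j)).
  rewrite mulmxBr orthogonalX // opprB -{2}(subnKC (ltnW lt_ij)) exprD.
  by rewrite -[_ ^+ i * _]/(_ *m _) mulmxA orthogonalX // mul1mx.
rewrite l1normN; apply: le_lt_trans (l1normM _ _) _.
have leO : l1norm (Q ^+ i)^T <= (n * n)%:R + 1.
  by rewrite l1norm_tr ler_wpDr // l1norm_orthogonal ?orthogonalX.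
apply: le_lt_trans (ler_wpM2r (l1norm_ge0 _) leO) _.
by rewrite mulrC -ltr_pdivlMr.
Qed.

(** The difference is the additive commutator of [Q - 1] and [C], times [Q^T *m C^T]; each
    orthogonal factor costs n^2. The bound is uniform in [C], so it serves all powers of [C] at
    once. *)
Lemma commutator_near1 Q C : Q^T *m Q = 1%:M -> C^T *m C = 1%:M ->
  l1norm (Q *m C *m Q^T *m C^T - 1%:M) <=
    2 * (n * n)%:R ^+ 3 * l1norm (Q - 1%:M).
Proof.
move=> QQ CC.
have -> : Q *m C *m Q^T *m C^T - 1%:M =
    ((Q - 1%:M) *m C - C *m (Q - 1%:M)) *m (Q^T *m C^T).
  rewrite [(Q - _) *m C]mulmxBl mul1mx [C *m (_ - _)]mulmxBr mulmx1.
  rewrite opprB addrA subrK.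
  rewrite mulmxBl !mulmxA.
  by rewrite -(mulmxA C Q) orthogonalV // mulmx1 orthogonalV.
have leQ := l1norm_orthogonal QQ; have leC := l1norm_orthogonal CC.
set d := l1norm (Q - _); set c := (n * n)%:R in leQ leC *.
have d0 : 0 <= d := l1norm_ge0 _.
have c0 : 0 <= c by exact: ler0n.
have le1 : l1norm ((Q - 1%:M) *m C - C *m (Q - 1%:M)) <= 2 * (d * c).
  apply: le_trans (l1normB _ _) _; rewrite mulr_natl mulr2n.
  apply: lerD; apply: le_trans (l1normM _ _) _; rewrite -/d.
    by rewrite ler_wpM2l.
  by rewrite mulrC ler_wpM2l.
have le2 : l1norm (Q^T *m C^T) <= c * c.
  by apply: le_trans (l1normM _ _) _; rewrite !l1norm_tr ler_pM ?l1norm_ge0.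
apply: le_trans (l1normM _ _) _.
have -> : 2 * c ^+ 3 * d = 2 * (d * c) * (c * c) by ring.
by rewrite ler_pM ?l1norm_ge0.
Qed.

(* With [P := Q C Q^T] commuting with [C], the powers of [P C^T] are the
   commutators of [Q] and [C ^+ j], all close to 1: no small subgroups. *)
Lemma commuting_conj_eq Q C : Q^T *m Q = 1%:M -> C^T *m C = 1%:M ->
  2 * (n * n)%:R ^+ 3 * l1norm (Q - 1%:M) <= 2^-1 ->
  comm_mx (Q *m C *m Q^T) C -> Q *m C *m Q^T = C.
Proof.
move=> QQ CC small; set P := Q *m C *m Q^T => PC.
have powP j : P ^+ j = Q *m C ^+ j *m Q^T.
  elim: j => [|j IHj]; first by rewrite !expr0 mulmx1 orthogonalV.
  rewrite !exprS IHj -[P * _]/(P *m _) -[C * _]/(C *m _) /P !mulmxA.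
  by rewrite -(mulmxA _ Q^T Q) QQ mulmx1.
(* [C^T] is the inverse of [C], so it also commutes with [P], and the powers of [P * C^T] split. *)
have PCT : GRing.comm P C^T.
  rewrite /GRing.comm -[P * _]/(P *m C^T) -[C^T * _]/(C^T *m P).
  rewrite -[RHS]mulmx1 -(orthogonalV CC) mulmxA -(mulmxA C^T) PC.
  by rewrite mulmxA CC mul1mx.
have PCT1 : P * C^T = 1.
  apply: pow_near1_eq1 => j; rewrite exprMn_comm // powP -trmxX.
  by apply: le_trans small; apply: commutator_near1; rewrite ?orthogonalX.
by rewrite -[LHS]mulmx1 -CC mulmxA -[P *m C^T]/(P * C^T) PCT1 mul1mx.
Qed.

End Orthogonal.

(** * Isometries as homogeneous matrices, and discrete groups of them *)

Section Affine.
Variables (F : archiRealFieldType) (n : nat).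

Definition aff (B : 'M[F]_n) (b : 'cV[F]_n) : 'M[F]_(n + 1) := block_mx B b 0 1.
Definition pt (x : 'cV[F]_n) : 'cV[F]_(n + 1) := col_mx x 1.

Lemma aff_pt B b x : aff B b *m pt x = pt (B *m x + b).
Proof. by rewrite mul_block_col mul0mx !mulmx1 add0r. Qed.

Lemma pt_inj : injective pt.
Proof. by move=> x y /eq_col_mx[]. Qed.

Lemma affM B b C c : aff B b * aff C c = aff (B *m C) (B *m c + b).
Proof.
by rewrite [LHS]mulmx_block !mulmx0 !mul0mx !mulmx1 !addr0 !add0r.
Qed.

Lemma aff1 : aff 1%:M 0 = 1.
Proof. by rewrite /aff -scalar_mx_block. Qed.

Lemma aff_inj B b C c : aff B b = aff C c -> B = C /\ b = c.
Proof. by move=> /eq_block_mx[]. Qed.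

Lemma affX B k : aff B 0 ^+ k = aff (B ^+ k) 0.
Proof.
elim: k => [|k IHk]; first by rewrite !expr0 aff1.
by rewrite !exprS IHk affM mulmx0 addr0.
Qed.

Lemma mulmx_pt (M P : 'M[F]_(n + 1)) (x : 'cV[F]_(n + 1)) :
  (M * P) *m x = M *m (P *m x).
Proof. by rewrite -mulmxA. Qed.

Record isometry_group (S : 'M[F]_(n + 1) -> Prop) : Prop := {
  igE : forall M, S M -> exists B b, M = aff B b /\ B^T *m B = 1%:M;
  ig1 : S 1;
  igM : forall M P, S M -> S P -> S (M * P);
  igV : forall M, S M -> exists P, [/\ S P, M * P = 1 & P * M = 1] }.

Lemma igX S (gS : isometry_group S) M k : S M -> S (M ^+ k).
Proof.
move=> SM; elim: k => [|k IHk]; first by rewrite expr0; apply: ig1.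
by rewrite exprS; apply: igM.
Qed.

(** By pigeonhole two powers [M ^+ i] and [M ^+ j] lie in the same left coset of [S'], so
    [M ^+ (j - i)] lies in [S']. *)
Lemma finite_index_power S S' (r : seq 'M[F]_(n + 1)) M :
  isometry_group S -> isometry_group S' -> {in r, forall P, S P} ->
  (forall P, S P -> exists Q Q', [/\ Q \in r, S' Q' & P = Q * Q']) ->
  S M -> exists p, (0 < p)%N /\ S' (M ^+ p).
Proof.
move=> gS gS' Sr covr SM.
have [|i [j [c [lt_ij [Pi [S'Pi eqi]] [Pj [S'Pj eqj]]]]]] :=
  @pigeonhole 'I_(size r) (fun i c => exists P, S' P /\ M ^+ i = r`_c * P).
  move=> i; have [Q [Q' [Qr S'Q' ->]]] := covr _ (igX gS i SM).
  have ltQ : (index Q r < size r)%N by rewrite index_mem.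
  by exists (Ordinal ltQ), Q'; rewrite /= nth_index.
exists (j - i)%N; split; first by rewrite subn_gt0.
have [Q [SQ _ Qr]] := igV gS (Sr _ (mem_nth 0 (ltn_ord c))).
have [P [S'P _ PPi]] := igV gS' S'Pi.
suff -> : M ^+ (j - i) = P * Pj by apply: igM.
have := congr1 (fun X => P * (Q * X)) eqj.
rewrite -{1}(subnKC (ltnW lt_ij)) exprD eqi.
by rewrite !mulrA -(mulrA P Q) Qr mulr1 PPi mul1r.
Qed.

(** The image of one point fixes the translation part, [b = y - B *m x]; the last 1 is the corner
    entry of the homogeneous matrix. *)
Lemma l1norm_isometry_le (B : 'M[F]_n) b x y : B^T *m B = 1%:M ->
  aff B b *m pt x = pt y ->
  l1norm (aff B b) <= (n * n)%:R + (l1norm y + (n * n)%:R * l1norm x) + 1.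
Proof.
move=> BB; rewrite aff_pt => /pt_inj eq_y.
have -> : b = y - B *m x by rewrite -eq_y addrC addKr.
rewrite l1norm_block; apply: lerD; last first.
  by rewrite l1norm0 add0r /l1norm !big_ord1 mxE normr1.
apply: lerD; first exact: l1norm_orthogonal.
apply: le_trans (l1normB _ _) _; rewrite lerD2l.
apply: le_trans (l1normM _ _) _; rewrite ler_wpM2r ?l1norm_ge0 //.
exact: l1norm_orthogonal.
Qed.

(** An isometry taking [x] to [y] is determined by its linear part. Two close linear parts make the
    quotient of [K i] and [K j] close to 1, and isolation of 1 makes it trivial. *)
Lemma point_pigeonhole S (eps : F) (K : nat -> 'M[F]_(n + 1)) x y :
  isometry_group S -> 0 < eps ->
  (forall M, S M -> l1norm (M - 1) < eps -> M = 1) ->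
  (forall i, S (K i)) -> (forall i, K i *m pt x = pt y) ->
  exists i j, (i < j)%N /\ K i = K j.
Proof.
move=> gS eps0 isol SK Kxy.
(* [c] bounds the inverse of [K i], which takes [y] to [x]; the factor [1 + l1norm x] below accounts
   for the two nonzero blocks of [K j - K i]. *)
set c := (n * n)%:R + (l1norm x + (n * n)%:R * l1norm y) + 1.
have c0 : 0 < c by rewrite ltr_wpDl // !addr_ge0 ?mulr_ge0 ?l1norm_ge0.
have d0 : 0 < 1 + l1norm x by rewrite ltr_pwDl ?l1norm_ge0.
pose O i : 'M_n := ulsubmx (K i).
have orthO i : (O i)^T *m O i = 1%:M /\ K i = aff (O i) (y - O i *m x).
  have [B [b [eqK BB]]] := igE gS (SK i).
  have -> : O i = B by rewrite /O eqK block_mxKul.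
  have := Kxy i; rewrite eqK aff_pt => /pt_inj <-.
  by rewrite addrC addKr.
have [i [j [lt_ij near]]] := orthogonal_pigeonhole (fun i => (orthO i).1)
  (divr_gt0 eps0 (mulr_gt0 c0 d0)).
exists i, j; split=> //.
have [Q [SQ KQ QK]] := igV gS (SK i).
suff QKj : Q * K j = 1 by rewrite -[LHS]mulr1 -QKj mulrA KQ mul1r.
apply: isol; first exact: igM.
have -> : Q * K j - 1 = Q *m (K j - K i) by rewrite mulmxBr [Q *m K i]QK.
apply: le_lt_trans (l1normM _ _) _.
have Qyx : Q *m pt y = pt x by rewrite -(Kxy i) -mulmx_pt QK mul1mx.
have leQ : l1norm Q <= c.
  have [B [b [eqQ BB]]] := igE gS SQ.
  by rewrite eqQ; apply: l1norm_isometry_le => //; rewrite -eqQ.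
apply: le_lt_trans (ler_wpM2r (l1norm_ge0 _) leQ) _.
rewrite (orthO i).2 (orthO j).2 /aff opp_block_mx add_block_mx !subrr.
rewrite l1norm_block.
have -> : y - O j *m x - (y - O i *m x) = (O i - O j) *m x.
  by rewrite opprB addrC addrA addrNK mulmxBl.
rewrite !l1norm0 !addr0 -[O j - _]opprB l1normN.
have : l1norm ((O i - O j) *m x) <= l1norm (O i - O j) * l1norm x.
  exact: l1normM.
move: near; rewrite ltr_pdivlMr ?mulr_gt0 // => near le_x.
apply: le_lt_trans near; rewrite mulrCA ler_pM2l //.
by rewrite mulrDr mulr1 lerD2l.
Qed.

(* All conjugates [g^-i h g^i] send [x] to the same point as [h]. *)
Lemma power_commutes S (eps : F) g h x y :
  isometry_group S -> 0 < eps ->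
  (forall M, S M -> l1norm (M - 1) < eps -> M = 1) ->
  S g -> S h -> h *m pt x = pt y ->
  (forall i, g ^+ i *m (h *m pt x) = h *m (g ^+ i *m pt x)) ->
  exists p, (0 < p)%N /\ g ^+ p * h = h * g ^+ p.
Proof.
move=> gS eps0 isol Sg Sh hxy gh.
have [g' [Sg' gg' g'g]] := igV gS Sg.
have gg'X i : g ^+ i * g' ^+ i = 1.
  rewrite -exprMn_comm ?gg' ?expr1n //; exact: etrans gg' (esym g'g).
have g'gX i : g' ^+ i * g ^+ i = 1.
  rewrite -exprMn_comm ?g'g ?expr1n //; exact: etrans g'g (esym gg').
have [|i|i [j [lt_ij eqK]]] :=
  @point_pigeonhole S eps (fun i => g' ^+ i * h * g ^+ i) x y gS eps0 isol.
- by move=> i; do ![apply: igM => //]; apply: igX.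
- by rewrite !mulmx_pt -gh -mulmx_pt g'gX mul1mx.
exists (j - i)%N; split; first by rewrite subn_gt0.
(* These factors turn the equality of the two conjugates of [h] into commutation with
   [g ^+ (j - i)]. *)
have := congr1 (fun X => g ^+ j * X * g' ^+ i) eqK.
rewrite -{1 4}(subnK (ltnW lt_ij)) !exprD !mulrA.
rewrite -(mulrA (g ^+ (j - i))) gg'X mulr1 gg'X mul1r.
by rewrite -!(mulrA _ (g ^+ i)) gg'X !mulr1.
Qed.

Definition translates (V : 'cV[F]_n -> Prop) (M : 'M[F]_(n + 1)) t :=
  forall x, V x -> V (x + t) /\ M *m pt x = pt (x + t).

Lemma translatesX V M t k : translates V M t -> translates V (M ^+ k) (t *+ k).
Proof.
move=> VMt; elim: k => [|k IHk] x Vx; first by rewrite addr0 expr0 mul1mx.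
have [Vk Mk] := IHk x Vx; have [Vk1 Mk1] := VMt _ Vk.
by rewrite exprS mulmx_pt Mk Mk1 mulrSr addrA; split.
Qed.

(** The squared Euclidean norm, which orthogonal maps preserve exactly, unlike [l1norm]. *)
Definition sqnorm (x : 'cV[F]_n) := \sum_i x i 0 ^+ 2.

Lemma sqnorm_eq0 x : sqnorm x = 0 -> x = 0.
Proof.
move=> /eqP; rewrite psumr_eq0 => [/allP x0|i _]; last exact: sqr_ge0.
apply/matrixP => i j; rewrite ord1 mxE; apply/eqP.
by have := x0 i (mem_index_enum i); rewrite sqrf_eq0.
Qed.

Lemma sqnorm_orthogonal (B : 'M[F]_n) x :
  B^T *m B = 1%:M -> sqnorm (B *m x) = sqnorm x.
Proof.
move=> BB; have sqE z : sqnorm z = (z^T *m z) 0 0.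
  by rewrite mxE; apply: eq_bigr => i _; rewrite mxE expr2.
by rewrite !sqE trmx_mul mulmxA -(mulmxA _ B^T) BB mulmx1.
Qed.

(* Two orbits of an isometry stay at a constant distance, so it translates
   [V] and [A V] by the same vector. *)
Lemma translates_conj V (g h : 'M[F]_(n + 1)) (A : 'M[F]_n) s t x :
  (exists B b, h = aff B b /\ B^T *m B = 1%:M) ->
  h * aff A 0 = aff A 0 * g -> translates V h s -> translates V g t -> V x ->
  s = A *m t.
Proof.
move=> [B [b [hE BB]]] hA Vs Vt Vx.
pose d := s - A *m t.
have hAp z : V z -> h *m pt (A *m z) = pt (A *m z + A *m t).
  move=> Vz; have <- : aff A 0 *m pt z = pt (A *m z) by rewrite aff_pt addr0.
  by rewrite -mulmx_pt hA mulmx_pt (Vt z Vz).2 aff_pt addr0 mulmxDr.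
(* [h] moves [z] by [s] and [A *m z'] by [A *m t], and preserves their distance. *)
have dist z z' : V z -> V z' ->
    sqnorm (z - A *m z' + d) = sqnorm (z - A *m z').
  move=> Vz Vz'.
  have := hAp z' Vz'; have := (Vs z Vz).2; rewrite hE !aff_pt.
  move=> /pt_inj hz /pt_inj hz'.
  rewrite -[RHS](sqnorm_orthogonal _ BB) mulmxBr; congr sqnorm.
  by rewrite /d addrACA -opprD -hz -hz' opprD addrACA subrr addr0.
have eq1 := dist x x Vx Vx.
have eq2 := dist _ _ (Vs x Vx).1 (Vt x Vx).1.
have e2 : x + s - A *m (x + t) = x - A *m x + d.
  by rewrite mulmxDr opprD addrACA.
rewrite e2 eq1 in eq2.
apply/eqP; rewrite -subr_eq0 -/d; apply/eqP/sqnorm_eq0.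
(* With [w = x - A *m x], the vectors [w], [w + d] and [w + d + d] have the same length, so the
   parallelogram law forces [d = 0]. *)
have : sqnorm (x - A *m x + d + d) + sqnorm (x - A *m x) =
       2 * sqnorm (x - A *m x + d) + 2 * sqnorm d.
  rewrite /sqnorm !mulr_sumr -!big_split /=; apply: eq_bigr => i _.
  by rewrite [(_ + d + d) i 0]mxE [(_ + d) i 0]mxE; ring.
by rewrite eq2 eq1; lra.
Qed.

End Affine.

(** * Conjugation by an expanding map and the translations it produces *)

Section Expanding.
Variables (F : archiRealFieldType) (n : nat).

Lemma scalemxX a (B : 'M[F]_n) k : (a *: B) ^+ k = a ^+ k *: B ^+ k.
Proof.
elim: k => [|k IHk]; first by rewrite !expr0 scale1r.
rewrite !exprS IHk [LHS](_ : _ = (a *: B) *m (a ^+ k *: B ^+ k)) //.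
by rewrite -scalemxAl -scalemxAr scalerA.
Qed.

Lemma conj_iter (S : 'M[F]_(n + 1) -> Prop) (A : 'M[F]_n) m g :
  (forall g, S g -> exists h, S h /\ h * aff A 0 = aff A 0 * g) ->
  S g -> exists h, S h /\ h * aff (A ^+ m) 0 = aff (A ^+ m) 0 * g.
Proof.
move=> conjS; elim: m g => [|m IHm] g Sg.
  by exists g; rewrite expr0 aff1 mul1r mulr1.
have [h [Sh hA]] := IHm g Sg; have [k [Sk kA]] := conjS h Sh.
by exists k; rewrite -affX exprS affX mulrA kA -mulrA hA mulrA.
Qed.

Lemma conjX (M g h : 'M[F]_(n + 1)) k : h * M = M * g -> h ^+ k * M = M * g ^+ k.
Proof.
move=> hM; elim: k => [|k IHk]; first by rewrite !expr0 mul1r mulr1.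
by rewrite exprS -mulrA IHk mulrA hM -mulrA -exprS.
Qed.

(* [h g^-1] has linear part 1, hence is the required translation. *)
Lemma commuting_conj_translation (S : 'M[F]_(n + 1) -> Prop) V (Q A : 'M[F]_n)
    (mu : F) g h s t x :
  isometry_group S -> Q^T *m Q = 1%:M ->
  2 * (n * n)%:R ^+ 3 * l1norm (Q - 1%:M) <= 2^-1 ->
  A = mu *: Q -> mu != 0 ->
  S g -> S h -> g * h = h * g -> h * aff A 0 = aff A 0 * g ->
  translates V g t -> translates V h s -> V x ->
  S (aff 1%:M (A *m t - t)).
Proof.
move=> gS QQ small AE mu0 Sg Sh gh hA Vt Vs Vx.
have sE : s = A *m t := translates_conj (igE gS Sh) hA Vs Vt Vx.
have [C [c [gE CC]]] := igE gS Sg; have [X [b [hE XX]]] := igE gS Sh.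
have [g' [Sg' gg' g'g]] := igV gS Sg; have [D [d [g'E _]]] := igE gS Sg'.
(* In the linear parts of [hA] the scalar [mu] cancels, so conjugation by [A] acts as conjugation by
   [Q]. *)
have XQ : X = Q *m C *m Q^T.
  move: hA; rewrite hE gE !affM AE => /aff_inj[XA _].
  move: XA; rewrite -scalemxAr -scalemxAl => /(scalerI mu0) <-.
  by rewrite -mulmxA orthogonalV // mulmx1.
have XC : X = C.
  rewrite XQ; apply: commuting_conj_eq => //; rewrite /comm_mx -XQ.
  by move: gh; rewrite gE hE !affM => /aff_inj[].
have CD : C *m D = 1%:M.
  by move: gg'; rewrite gE g'E affM -aff1 => /aff_inj[].
have hg'E : h * g' = aff 1%:M (X *m d + b) by rewrite hE g'E affM XC CD.
(* [h] sends [x] to [x + s] and [g] sends it to [x + t], so the translation [h * g'] has vector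
   [s - t = A *m t - t]. *)
have : h *m pt x = (h * g') *m (g *m pt x).
  by rewrite -mulmx_pt -mulrA g'g mulr1.
rewrite (Vs x Vx).2 (Vt x Vx).2 hg'E aff_pt mul1mx => /pt_inj.
rewrite -addrA => /addrI eq_s.
have -> : A *m t - t = X *m d + b by rewrite -sE eq_s addrAC subrr add0r.
by rewrite -hg'E; apply: igM.
Qed.

(** The exponent [m] depends on [A'] alone and only [p] depends on [g]: the rank comparison applies
    one map [A ^+ m - 1] to all translation vectors. *)
Lemma expanding_translations (S S0 : 'M[F]_(n + 1) -> Prop) V
    (r : seq 'M[F]_(n + 1)) (A A' : 'M[F]_n) (lam eps : F) x :
  isometry_group S -> isometry_group S0 -> (forall M, S0 M -> S M) ->
  0 < eps -> (forall M, S M -> l1norm (M - 1) < eps -> M = 1) ->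
  {in r, forall P, S P} ->
  (forall P, S P -> exists Q Q', [/\ Q \in r, S0 Q' & P = Q * Q']) ->
  A'^T *m A' = 1%:M -> A = lam *: A' -> lam != 0 ->
  (forall g, S g -> exists h, S h /\ h * aff A 0 = aff A 0 * g) ->
  (forall g, S0 g -> exists t, translates V g t) -> V x ->
  exists m, (0 < m)%N /\
    forall g t, S0 g -> translates V g t ->
      exists p, (0 < p)%N /\ S (aff 1%:M ((A ^+ m *m t - t) *+ p)).
Proof.
move=> gS gS0 S0S eps0 isol Sr covr AA AE lam0 conjS transV Vx.
(* A distance to 1 below [1 / (4 (n^6 + 1))] meets the smallness condition of
   [commuting_conj_translation]; the summand 1 covers [n = 0]. *)
have c0 : 0 < 4 * ((n * n)%:R ^+ 3 + 1) :> F.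
  by rewrite mulr_gt0 // ltr_wpDl // exprn_ge0.
have [m [m0 near]] := orthogonal_recurrence AA (divr_gt0 ltr01 c0).
exists m; split=> // g t S0g Vt.
have [h [Sh hA]] := conj_iter m conjS (S0S g S0g).
(* Both [h ^+ p] and [g ^+ p] lie in [S0] and translate [V], so their actions on [V] commute, as
   [power_commutes] requires. *)
have [p [p0 S0hp]] := finite_index_power gS gS0 Sr covr Sh.
have [s Vs] := transV _ S0hp.
have S0gp := igX gS0 p S0g.
have Vgp := translatesX p Vt.
have [|q [q0 ghq]] :=
  power_commutes gS eps0 isol (S0S _ S0gp) (S0S _ S0hp) (Vs x Vx).2.
  move=> i; have Vgi := translatesX i Vgp.
  rewrite (Vs x Vx).2 (Vgi x Vx).2 (Vs _ (Vgi x Vx).1).2.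
  by rewrite (Vgi _ (Vs x Vx).1).2 addrAC.
exists (p * q)%N; split; first by rewrite muln_gt0 p0.
have gq := translatesX q Vgp; have hq := translatesX q Vs.
have -> : (A ^+ m *m t - t) *+ (p * q) = A ^+ m *m (t *+ p *+ q) - t *+ p *+ q.
  by rewrite -!mulrnA mulrnBl -!scaler_nat scalemxAr.
apply: (commuting_conj_translation (Q := A' ^+ m) (mu := lam ^+ m)
  (g := (g ^+ p) ^+ q) (h := (h ^+ p) ^+ q) gS _ _ _ _ _ _ _ _ gq hq Vx).
- exact: orthogonalX.
- move: near; rewrite ltr_pdivlMr //.
  have := l1norm_ge0 (A' ^+ m - 1).
  rewrite -[1%:M]/(1 : 'M_n).
  set l := l1norm _; set c := _ ^+ 3; lra.
- by rewrite AE scalemxX.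
- exact: expf_neq0.
- exact: S0S _ (igX gS0 q S0gp).
- exact: S0S _ (igX gS0 q S0hp).
- exact: commrX ghq.
- by do 2!apply: conjX.
Qed.

(** For a row u of [U], each multiple j u is within [rad] of [T], so j times the norm of u [phi] is
    at most [rad * l1norm phi] for every j. This is how cocompactness makes translation vectors span
    the direction. *)
Lemma coarsely_dense_annihilator k q (T : 'cV[F]_n -> Prop) (U : 'M[F]_(k, n))
    (phi : 'M[F]_(n, q)) (rad : F) :
  (forall w : 'rV[F]_k, exists t, T t /\ l1norm (t - (w *m U)^T) <= rad) ->
  (forall t, T t -> t^T *m phi = 0) -> U *m phi = 0.
Proof.
move=> dense Tphi; apply/row_matrixP => i; rewrite row0 row_mul.
apply: l1norm_eq0.
suff -> : l1norm (row i U *m phi) = 0 by [].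
apply: (@bounded_multiples_eq0 _ _ (rad * l1norm phi)); first exact: l1norm_ge0.
move=> j; have [t [Tt le_rad]] := dense (delta_mx 0 i *+ j).
have -> : l1norm (row i U *m phi) *+ j =
    l1norm ((t - (delta_mx 0 i *+ j *m U)^T)^T *m phi).
  rewrite linearB /= trmxK mulmxBl Tphi // sub0r l1normN.
  rewrite -scaler_nat -!scalemxAl -rowE l1normZ normr_nat.
  by rewrite mulr_natl.
apply: le_trans (l1normM _ _) _.
by rewrite l1norm_tr ler_wpM2r ?l1norm_ge0.
Qed.

(** [mu *: Q] multiplies lengths by [mu], hence fixes only 0. The transpose fits directions stored
    as row spaces. *)
Lemma expanding_sub1_row_free (Q : 'M[F]_n) (mu : F) :
  Q^T *m Q = 1%:M -> 1 < mu -> row_free (mu *: Q - 1%:M)^T.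
Proof.
move=> QQ mu1; apply/inj_row_free => v v0.
have muQ : mu *: (Q *m v^T) = v^T.
  apply/eqP; rewrite -subr_eq0 scalemxAl -{2}(mul1mx v^T) -mulmxBl.
  by rewrite -trmx_eq0 trmx_mul trmxK v0.
have sq_v : mu ^+ 2 * sqnorm v^T = sqnorm v^T.
  rewrite -{1}(sqnorm_orthogonal v^T QQ) -{2}muQ /sqnorm mulr_sumr.
  by apply: eq_bigr => i _; rewrite [in RHS]mxE exprMn.
apply: trmx_inj; rewrite trmx0; apply: sqnorm_eq0.
have : (mu ^+ 2 - 1) * sqnorm v^T = 0 by rewrite mulrBl sq_v mul1r subrr.
move=> /eqP; rewrite mulf_eq0 subr_eq0 => /orP[|/eqP //].
by rewrite gt_eqF // exprn_egt1.
Qed.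

End Expanding.

(** * Cocompact translation pairs and comparison of their ranks *)

Section Pairs.
Variables (F : archiRealFieldType) (n : nat).
Implicit Types (S : 'M[F]_(n + 1) -> Prop) (V : 'cV[F]_n -> Prop).

(** The direction of [V] is stored as the row space of [U], so its dimension is [k]; [ftp_dense] is
    cocompactness restated for translation vectors. *)
Record fi_translation_pair S S0 V k (U : 'M[F]_(k, n)) : Prop := {
  ftp_group : isometry_group S;
  ftp_subgroup : isometry_group S0;
  ftp_sub : forall M, S0 M -> S M;
  ftp_free : row_free U;
  ftp_point : exists x, V x;
  ftp_translates : forall M, S0 M -> exists t, translates V M t;
  ftp_direction : forall x y, V x -> V y -> ((y - x)^T <= U)%MS;
  ftp_dense : exists rad, forall w : 'rV[F]_k, exists t,
    (exists M, S0 M /\ translates V M t) /\ l1norm (t - (w *m U)^T) <= rad;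
  ftp_index : exists r : seq 'M[F]_(n + 1), {in r, forall P, S P} /\
    forall P, S P -> exists Q Q', [/\ Q \in r, S0 Q' & P = Q * Q'] }.

Lemma submx_mulrn k (U : 'M[F]_(k, n)) (v : 'cV[F]_n) p :
  (0 < p)%N -> ((v *+ p)^T <= U)%MS -> (v^T <= U)%MS.
Proof.
move=> p0; rewrite -scaler_nat linearZ /= => /(scalemx_sub p%:R^-1).
by rewrite scalerA mulVf ?scale1r // pnatr_eq0 -lt0n.
Qed.

Lemma aff1X (b : 'cV[F]_n) k : aff 1%:M b ^+ k = aff 1%:M (b *+ k).
Proof.
elim: k => [|k IHk]; first by rewrite expr0 mulr0n aff1.
by rewrite exprS IHk affM !mul1mx mulrSr.
Qed.

(** A translation in [S] may move [V] off itself, but a power of it lies in [S0] and preserves [V],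
    so a positive multiple of [b] is a difference of two points of [V]. *)
Lemma translation_direction S S0 V k (U : 'M[F]_(k, n)) b :
  fi_translation_pair S S0 V U -> S (aff 1%:M b) -> (b^T <= U)%MS.
Proof.
move=> prV Sb; have [r [Sr covr]] := ftp_index prV.
have [p [p0]] := finite_index_power (ftp_group prV) (ftp_subgroup prV) Sr covr Sb.
rewrite aff1X => S0b; apply: (submx_mulrn p0).
have [x Vx] := ftp_point prV; have [t Vt] := ftp_translates prV S0b.
have [Vxt] := Vt x Vx; rewrite aff_pt mul1mx => /pt_inj xb.
have := ftp_direction prV Vx Vxt; rewrite -xb.
by rewrite addrAC subrr add0r.
Qed.

(** With [phi] built from a cokernel matrix, inclusions of row spaces reduce to a check on
    translation vectors. *)
Lemma ftp_annihilator S S0 V k q (U : 'M[F]_(k, n)) (phi : 'M[F]_(n, q)) :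
  fi_translation_pair S S0 V U ->
  (forall M t, S0 M -> translates V M t -> t^T *m phi = 0) -> U *m phi = 0.
Proof.
move=> prV phi0; have [rad dense] := ftp_dense prV.
by apply: coarsely_dense_annihilator dense _ => t [M [S0M /phi0->]].
Qed.

(** Each rank inequality comes from an inclusion: the row space of [U'] lies in that of [U], and the
    injective map [A ^+ m - 1] carries the row space of [U] into that of [U']. *)
Theorem expanding_rank_eq S S0 ST ST0 V W k l (U : 'M[F]_(k, n))
    (U' : 'M[F]_(l, n)) (A A' : 'M[F]_n) (lam eps : F) :
  fi_translation_pair S S0 V U -> fi_translation_pair ST ST0 W U' ->
  (forall M, ST M <-> S M /\ exists b, M = aff 1%:M b) ->
  0 < eps -> (forall M, S M -> l1norm (M - 1) < eps -> M = 1) ->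
  A'^T *m A' = 1%:M -> A = lam *: A' -> 1 < lam ->
  (forall g, S g -> exists h, S h /\ h * aff A 0 = aff A 0 * g) ->
  l = k.
Proof.
move=> prV prW STE eps0 isol AA AE lam1 conjS.
have lam0 : lam != 0 by rewrite gt_eqF // (lt_trans ltr01).
rewrite -(eqP (ftp_free prV)) -(eqP (ftp_free prW)); apply/eqP.
rewrite eqn_leq; apply/andP; split.
  apply: mxrankS; rewrite submxE; apply/eqP.
  apply: (ftp_annihilator prW) => M t ST0M Wt; apply/eqP; rewrite -submxE.
  have /STE[SM [b ME]] := ftp_sub prW ST0M; have [x Wx] := ftp_point prW.
  have := (Wt x Wx).2; rewrite ME aff_pt mul1mx => /pt_inj/addrI <-.
  by apply: (translation_direction prV); rewrite -ME.
have [x Vx] := ftp_point prV; have [r [Sr covr]] := ftp_index prV.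
have [m [m0 transS]] := expanding_translations (ftp_group prV)
  (ftp_subgroup prV) (ftp_sub prV) eps0 isol Sr covr AA AE lam0 conjS
  (ftp_translates prV) Vx.
have freeA : row_free (A ^+ m - 1%:M)^T.
  rewrite AE scalemxX expanding_sub1_row_free ?orthogonalX //.
  by rewrite exprn_egt1 // -lt0n.
rewrite -(mxrankMfree U freeA); apply: mxrankS; rewrite submxE; apply/eqP.
(* Here [phi] is [(A ^+ m - 1%:M)^T *m cokermx U']. *)
rewrite -mulmxA; apply: (ftp_annihilator prV) => M t S0M Vt.
rewrite mulmxA -trmx_mul mulmxBl mul1mx; apply/eqP; rewrite -submxE.
have [p [p0 Sp]] := transS M t S0M Vt.
apply: (submx_mulrn p0); apply: (translation_direction prW).
by apply/STE; split=> //; exists ((A ^+ m *m t - t) *+ p).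
Qed.

End Pairs.

(** * Passage from vectors and matrices given as functions to real matrices *)

Lemma mem_map_In (T : Type) (T' : eqType) (f : T -> T') (s : seq T) y :
  y \in map f s <-> exists x, List.In x s /\ y = f x.
Proof.
elim: s => [|a s IHs] /=; first by split=> // [[x []]].
rewrite inE; split=> [/orP[/eqP->|/IHs[x [sx ->]]]|[x [[<-|sx] yE]]].
- by exists a; split; first left.
- by exists x; split; first right.
- by rewrite yE eqxx.
- by apply/orP; right; apply/IHs; exists x.
Qed.

Section Bridge.
Variable n : nat.
Implicit Types (B C : mat n) (x y : vec n) (g h : isom n) (Gam : isom n -> Prop).

Definition mx B : 'M[R]_n := \matrix_(i, j) B i j.
Definition cv x : 'cV[R]_n := \col_i x i.
Definition hom g : 'M[R]_(n + 1) := aff (mx (ort g)) (cv (transl g)).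
Definition homset Gam (M : 'M[R]_(n + 1)) := exists g, Gam g /\ M = hom g.
Definition cvset (V : vec n -> Prop) (y : 'cV[R]_n) := exists x, V x /\ y = cv x.

Lemma mx_inj : injective mx.
Proof.
move=> B C /matrixP eqBC; apply: functional_extensionality => i.
by apply: functional_extensionality => j; have := eqBC i j; rewrite !mxE.
Qed.

Lemma mx_mulmm B C : mx (mulmm B C) = mx B *m mx C.
Proof.
by apply/matrixP => i j; rewrite !mxE; apply: eq_bigr => k _; rewrite !mxE.
Qed.

Lemma mx_idm : mx (@idm n) = 1%:M.
Proof. by apply/matrixP => i j; rewrite !mxE /idm; case: (i == j). Qed.

Lemma mx_scalem l B : mx (scalem l B) = l *: mx B.
Proof. by apply/matrixP => i j; rewrite !mxE. Qed.

Lemma mx_orthogonal B : orthogonal B -> (mx B)^T *m mx B = 1%:M.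
Proof.
move=> BB; rewrite -mx_idm; apply/matrixP => i j; rewrite !mxE -BB.
by apply: eq_bigr => k _; rewrite !mxE.
Qed.

Lemma cv_vzero : cv (@vzero n) = 0.
Proof. by apply/matrixP => i j; rewrite !mxE. Qed.

Lemma cv_vadd x y : cv (vadd x y) = cv x + cv y.
Proof. by apply/matrixP => i j; rewrite !mxE. Qed.

Lemma cv_vsub x y : cv (vsub x y) = cv x - cv y.
Proof. by apply/matrixP => i j; rewrite !mxE. Qed.

Lemma cv_mulmv B x : cv (mulmv B x) = mx B *m cv x.
Proof.
by apply/matrixP => i j; rewrite !mxE; apply: eq_bigr => k _; rewrite !mxE.
Qed.

Lemma cv_lin_comb k (c : 'I_k -> R) (U : 'I_k -> vec n) :
  cv (lin_comb c U) = ((\row_l c l) *m (\matrix_(l, i) U l i))^T.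
Proof.
by apply/matrixP => i j; rewrite !mxE; apply: eq_bigr => l _; rewrite !mxE.
Qed.

Lemma hom_pt g x : hom g *m pt (cv x) = pt (cv (act g x)).
Proof. by rewrite aff_pt cv_vadd cv_mulmv. Qed.

Lemma hom_comp g h : hom (isom_comp g h) = hom g * hom h.
Proof. by rewrite affM /hom mx_mulmm cv_vadd cv_mulmv. Qed.

Lemma hom_id : hom (@isom_id n) = 1.
Proof. by rewrite /hom mx_idm cv_vzero aff1. Qed.

(** The homogeneous matrices differ only in their upper blocks, so discreteness at the identity
    carries over with the same [eps]. *)
Lemma isom_distE g : isom_dist (@isom_id n) g = l1norm (hom g - 1).
Proof.
rewrite -hom_id -l1normN opprB /hom /aff opp_block_mx add_block_mx !subrr.
rewrite l1norm_block !l1norm0 !addr0; congr (_ + _).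
  by apply: eq_bigr => i _; apply: eq_bigr => j _; rewrite !mxE RabsE.
by apply: eq_bigr => i _; rewrite big_ord1 !mxE RabsE.
Qed.

Lemma homset_group Gam : subgroup_E Gam -> isometry_group (homset Gam).
Proof.
move=> [orthG [G1 [GM GV]]]; split.
- move=> _ [g [Gg ->]]; exists (mx (ort g)), (cv (transl g)); split=> //.
  exact/mx_orthogonal/orthG.
- by exists (@isom_id n); rewrite hom_id.
- move=> _ _ [g [Gg ->]] [h [Gh ->]]; exists (isom_comp g h).
  by split; [exact: GM | rewrite hom_comp].
- move=> _ [g [Gg ->]]; have [h [Gh [gh hg]]] := GV g Gg.
  by exists (hom h); rewrite -!hom_comp gh hg hom_id; split=> //; exists h.
Qed.

Lemma transl_subgroup_E Gam : subgroup_E Gam -> subgroup_E (transl_subgroup Gam).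
Proof.
move=> [orthG [G1 [GM GV]]]; split; last split; last split.
- by move=> g [/orthG].
- by [].
- move=> g h [Gg g1] [Gh h1]; split; first exact: GM.
  by apply: mx_inj; rewrite /isom_comp /= g1 h1 mx_mulmm mx_idm mulmx1.
- move=> g [Gg g1]; have [h [Gh [gh hg]]] := GV g Gg.
  exists h; split=> //; split=> //; apply: mx_inj.
  have := congr1 (fun k => mx (ort k)) gh.
  by rewrite /= mx_mulmm g1 mx_idm mul1mx.
Qed.

Lemma homset_transl Gam M : homset (transl_subgroup Gam) M <->
  homset Gam M /\ exists b, M = aff 1%:M b.
Proof.
split=> [[g [[Gg g1] ->]]|[[g [Gg ->]] [b]]].
  by split; [exists g | exists (cv (transl g)); rewrite /hom g1 mx_idm].
move=> /aff_inj[g1 _]; exists g; split=> //; split=> //.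
by apply: mx_inj; rewrite g1 mx_idm.
Qed.

Lemma homset_isolated Gam : subgroup_E Gam -> discrete Gam ->
  exists eps, 0 < eps /\
    forall M, homset Gam M -> l1norm (M - 1) < eps -> M = 1.
Proof.
move=> [_ [G1 _]] /(_ _ G1)[eps [/RltP eps0 isol]].
exists eps; split=> // _ [g [Gg ->]]; rewrite -isom_distE => near.
have [->|/(isol _ Gg)/RleP] := classic (g = @isom_id n); first exact: hom_id.
by rewrite leNgt near.
Qed.

Lemma homset_conj (A : mat n) Gam : conj_into A Gam ->
  forall M, homset Gam M ->
  exists P, homset Gam P /\ P * aff (mx A) 0 = aff (mx A) 0 * M.
Proof.
move=> conjA _ [g [Gg ->]]; have [h [Gh hA]] := conjA g Gg.
exists (hom h); split; first by exists h.
rewrite /hom !affM mulmx0 add0r addr0.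
have hA' (x : 'cV[R]_n) : mx (ort h) *m (mx A *m x) + cv (transl h) =
    mx A *m (mx (ort g) *m x + cv (transl g)).
  have xE : x = cv (fun i => x i 0).
    by apply/matrixP => i j; rewrite mxE ord1.
  rewrite xE -!cv_mulmv -!cv_vadd -cv_mulmv; congr cv.
  exact: hA.
(* Evaluation at 0 identifies the translation parts; evaluation at the basis vectors then identifies
   the linear parts column by column. *)
have tE : cv (transl h) = mx A *m cv (transl g).
  by have := hA' 0; rewrite !mulmx0 !add0r.
rewrite tE; congr aff; apply/matrixP => i j.
have := hA' (delta_mx j 0); rewrite mulmxDr tE => /addIr.
rewrite !mulmxA -!colE => /matrixP/(_ i 0).
by rewrite [LHS]mxE [RHS]mxE.
Qed.

Lemma l1norm_cv_le x : l1norm (cv x) <= n%:R * vnorm x.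
Proof.
rewrite -[n in n%:R]muln1; apply: l1norm_le => i j; rewrite mxE.
have sumE : Rsum (fun k => x k * x k)%R = \sum_k x k ^+ 2.
  by apply: eq_bigr => k _; rewrite expr2.
rewrite /vnorm RsqrtE sumE -sqrtr_sqr ler_wsqrtr // (bigD1 i) //= lerDl.
by apply: sumr_ge0 => k _; rewrite sqr_ge0.
Qed.

Lemma row_free_lin_indep k (U : 'I_k -> vec n) :
  lin_indep U -> row_free (\matrix_(l, i) U l i).
Proof.
move=> indU; apply/inj_row_free => v v0.
apply/matrixP => i l; rewrite ord1 mxE; apply: (indU (fun l => v 0 l)).
apply: functional_extensionality => j.
have := congr1 (fun M : 'rV_n => M 0 j) v0; rewrite !mxE => sum0.
by apply: etrans _ sum0; apply: eq_bigr => m _; rewrite !mxE.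
Qed.

Lemma homset_pair Gam (G : isom n -> Prop) V k :
  subgroup_E Gam -> fi_cocompact_translation_pair Gam G V -> affine_dim V k ->
  exists U : 'M[R]_(k, n),
    fi_translation_pair (homset Gam) (homset G) (cvset V) U.
Proof.
move=> gGam [[gG [sGG [_ [actG [x0 [Vx0 [Rad dense]]]]]]] [r [Gr covr]]].
move=> [p [U [indU VE]]].
have transl_hom g t : G g -> (forall x, V x -> act g x = vadd x t) ->
    translates (cvset V) (hom g) (cv t).
  move=> Gg gt _ [x [Vx ->]]; rewrite -cv_vadd -(gt x Vx) hom_pt; split=> //.
  by exists (act g x); split=> //; apply: (actG g Gg).1.
exists (\matrix_(l, i) U l i); split.
- exact: homset_group.
- exact: homset_group.
- by move=> _ [g [Gg ->]]; exists g; split=> //; apply: sGG.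
- exact: row_free_lin_indep.
- by exists (cv x0), x0.
- move=> _ [g [Gg ->]]; have [_ [_ [t gt]]] := actG g Gg.
  by exists (cv t); apply: transl_hom.
- move=> _ _ [x [/VE[c ->] ->]] [y [/VE[d ->] ->]].
  rewrite !cv_vadd opprD addrACA subrr add0r !cv_lin_comb -linearB /= trmxK.
  by rewrite -mulmxBl submxMl.
(* The factor [n] converts the Euclidean radius into an l1 radius. *)
- exists (n%:R * Rad) => w.
  have /VE[c0 x0E] := Vx0.
  (* If an element of [G] takes [x0] within [Rad] of [v], its translation vector is within [Rad] of
     the displacement from [x0] to [v], the combination of [U] with coefficients [w]. *)
  pose v := vadd x0 (lin_comb (fun l => w 0 l) U).
  have Vv : V v.
    apply/VE; exists (fun l => c0 l + w 0 l).
    rewrite /v x0E; apply: functional_extensionality => i.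
    rewrite /vadd !RplusE -addrA; congr (_ + _); rewrite -big_split /=.
    by apply: eq_bigr => l _; exact/esym/mulrDl.
  have [g [Gg /RleP near]] := dense v Vv.
  have [_ [_ [t gt]]] := actG g Gg.
  exists (cv t); split.
    by exists (hom g); split; [exists g | exact: transl_hom].
  move: near; rewrite gt // => near.
  have -> : cv t - (w *m \matrix_(l, i) U l i)^T = cv (vsub (vadd x0 t) v).
    rewrite cv_vsub !cv_vadd opprD addrACA subrr add0r cv_lin_comb.
    by congr (_ - (_ *m _)^T); apply/matrixP => i j; rewrite mxE ord1.
  by apply: le_trans (l1norm_cv_le _) _; rewrite ler_wpM2l.
(* Isometries are pairs of functions, listed through [List.In]; their homogeneous matrices have
   decidable equality, so [\in] applies. *)
- exists (map hom r); split.
    by move=> _ /mem_map_In[g [rg ->]]; exists g; split=> //; apply: Gr.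
  move=> _ [g [Gg ->]]; have [s [h [rs [Gh ->]]]] := covr g Gg.
  exists (hom s), (hom h); rewrite hom_comp; split=> //; last by exists h.
  by apply/mem_map_In; exists s.
Qed.

End Bridge.

Theorem theorem1p5 (n : nat) (Gam : isom n -> Prop) (A : mat n) :
  subgroup_E Gam -> discrete Gam ->
  expanding_conformal A -> conj_into A Gam ->
  forall (G H : isom n -> Prop) (V W : vec n -> Prop) (dG dT : nat),
    fi_cocompact_translation_pair Gam G V -> affine_dim V dG ->
    fi_cocompact_translation_pair (transl_subgroup Gam) H W -> affine_dim W dT ->
    dT = dG.
Proof.
move=> gG dG [lam [A' [/RltP lam1 [[AA _] ->]]]] conjA G H V W k l prV dV prW dW.
have [U pU] := homset_pair gG prV dV.
have [U' pU'] := homset_pair (transl_subgroup_E gG) prW dW.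
have [eps [eps0 isol]] := homset_isolated gG dG.
apply: (expanding_rank_eq pU pU' (@homset_transl _ Gam) eps0 isol
  (mx_orthogonal AA) (mx_scalem lam A') lam1).
exact: homset_conj.
Qed.
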